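(* Let $G$ be a discrete group and let $H$ be a finite subgroup of $G$ (so that $(G,H)$ is a Hecke pair). Then the group $G$ has property (RD) if and only if the Hecke pair $(G,H)$ has property (RD).
   Context: All groups are discrete. A length function on a group $G$ is a function $L:G\to[0,\infty)$ with $L(gh)\le L(g)+L(h)$, $L(g)=L(g^{-1})$ for all $g,h\in G$, and $L(1)=0$. Property (RD) for groups: $G$ has property (RD) if there exist a length function $L$ on $G$ and positive real numbers $C,s$ such that $\|\lambda(f)\|\le C\|f\|_{s,L}$ for all finitely supported $f:G\to\mathbb{C}$, where $\lambda(f)$ is the operator $\xi\mapsto f*\xi$ on $\ell^2(G)$, $\|\lambda(f)\|$ is its operator norm, and $\|f\|_{s,L}=\left(\sum_{g\in G}|f(g)|^2(1+L(g))^{2s}\right)^{1/2}$. Hecke pairs: a pair $(G,H)$ with $H\le G$ is a Hecke pair if every double coset $HgH$ ($g\in G$) is a finite union of left cosets of $H$ (equivalently, every double coset is a finite union of right cosets $Hx$). Let $H\backslash G$ be the set of right cosets $Hg$ and $G//H$ the set of double cosets $HgH$; functions on these sets are regarded as left $H$-invariant, respectively $H$-bi-invariant, functions on $G$. $\mathcal{H}(G,H)$ is the space of finitely supported functions $G//H\to\mathbb{C}$. For $f\in\mathcal{H}(G,H)$ and $\xi\in\ell^2(H\backslash G)$ put $$\lambda(f)\xi(g)=(f*\xi)(g)=\sum_{\gamma H\in G/H} f(\gamma)\xi(\gamma^{-1}g)=\sum_{H\gamma\in H\backslash G} f(g\gamma^{-1})\xi(\gamma),$$ a bounded operator on $\ell^2(H\backslash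 G)$ whose operator norm is $\|\lambda(f)\|$. A length function on the Hecke pair $(G,H)$ is a length function $L$ on $G$ with $L(h)=0$ for all $h\in H$ (then $L$ is constant on double cosets). For $s>0$ and $f:G//H\to\mathbb{C}$ put $\|f\|_{s,L}=\left(\sum_{Hg\in H\backslash G}|f(g)|^2(1+L(g))^{2s}\right)^{1/2}$. Property (RD) for Hecke pairs: $(G,H)$ has property (RD) if there exist a length function $L$ on $(G,H)$ and positive real numbers $C,s$ such that $\|\lambda(f)\|\le C\|f\|_{s,L}$ for all $f\in\mathcal{H}(G,H)$. *)

(* Defs.v *)
From mathcomp Require Import all_boot all_order all_algebra.
From mathcomp Require Import all_classical all_reals all_analysis.
From mathcomp Require Export complex.

Set Implicit Arguments.
Unset Strict Implicit.
Unset Printing Implicit Defensive.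

Import Order.TTheory GRing.Theory Num.Theory.
Import Normc.

Local Open Scope classical_set_scope.
Local Open Scope ring_scope.

Section OperatorNorm.
Context {R : realType} {V : Type}.

(* Norms of square-summable functions are [\bar R]-valued, with value [+oo]
   off l^2; the unit ball below therefore consists of l^2 elements only, and
   the operator norm of an unbounded operator is [+oo]. *)
Definition op_norm (D : set V) (N : V -> \bar R) (T : V -> V) : \bar R :=
  ereal_sup [set N (T x) | x in [set x | D x /\ (N x <= 1)%E]].

End OperatorNorm.

Section Groups.
Context {R : realType} {G : groupType}.
Implicit Types (L : G -> R) (f xi : G -> R[i]).

Definition length_function L : Prop :=
  [/\ forall g, 0 <= L g,
      forall g h, L (g * h)%g <= L g + L h,
      forall g, L g = L (g^-1)%g
    & L 1%g = 0].

Definition l2norm xi : \bar R :=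
  sqrte (\esum_(g in [set: G]) (normc (xi g) ^+ 2)%:E).

Definition sobolev_norm (s : R) L f : \bar R :=
  sqrte (\esum_(g in [set: G])
           (normc (f g) ^+ 2 * (1 + L g) `^ (2 * s))%:E).

Definition finitely_supported f : Prop := finite_set [set g | f g != 0].

(* The sum is finitely supported (hence meaningful) for finitely supported f. *)
Definition convolution f xi : G -> R[i] := fun g =>
  \sum_(gam \in [set: G]) f gam * xi (gam^-1 * g)%g.

End Groups.

Definition property_RD (R : realType) (G : groupType) : Prop :=
  exists L : G -> R, length_function L /\
  exists C s : R, [/\ 0 < C, 0 < s &
    forall f : G -> R[i], finitely_supported f ->
      (op_norm [set: G -> R[i]] l2norm (convolution f)
         <= C%:E * sobolev_norm s L f)%E].

Section HeckePairs.
Context {R : realType} {G : groupType} (H : set G).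
Implicit Types (L : G -> R) (f xi : G -> R[i]).

Definition left_coset (g : G) : set G := [set (g * h)%g | h in H].
Definition right_coset (g : G) : set G := [set (h * g)%g | h in H].
Definition double_coset (g : G) : set G :=
  [set (h * g * k)%g | h in H & k in H].

Definition left_cosets : set (set G) := range left_coset.
Definition right_cosets : set (set G) := range right_coset.

(* Functions on cosets are invariant functions on G; a sum over cosets
   evaluates its (invariant) summand at a chosen element of each coset. *)
Definition coset_repr (S : set G) : G := xget 1%g S.

Definition hecke_pair : Prop :=
  group_closed [in H] /\
  forall g : G, exists A : set G,
    finite_set A /\ double_coset g = \bigcup_(x in A) left_coset x.

Definition left_invariant xi : Prop :=
  forall h g, H h -> xi (h * g)%g = xi g.

Definition bi_invariant f : Prop :=
  forall h g k, H h -> H k -> f (h * g * k)%g = f g.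

Definition hecke_algebra : set (G -> R[i]) :=
  [set f | bi_invariant f /\
     finite_set [set double_coset g | g in [set g | f g != 0]]].

Definition hecke_length_function L : Prop :=
  length_function L /\ forall h, H h -> L h = 0.

Definition hecke_l2norm xi : \bar R :=
  sqrte (\esum_(S in right_cosets) (normc (xi (coset_repr S)) ^+ 2)%:E).

Definition hecke_sobolev_norm (s : R) L f : \bar R :=
  sqrte (\esum_(S in right_cosets)
           (normc (f (coset_repr S)) ^+ 2
              * (1 + L (coset_repr S)) `^ (2 * s))%:E).

(* For a Hecke pair and f in the Hecke algebra, f is nonzero on only finitely
   many left cosets, and for left-invariant xi the summand depends only on the
   left coset of gam. *)
Definition hecke_convolution f xi : G -> R[i] := fun g =>
  \sum_(S \in left_cosets)
     f (coset_repr S) * xi ((coset_repr S)^-1 * g)%g.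

End HeckePairs.

Definition hecke_property_RD (R : realType) (G : groupType) (H : set G) :
    Prop :=
  exists L : G -> R, hecke_length_function H L /\
  exists C s : R, [/\ 0 < C, 0 < s &
    forall f : G -> R[i], hecke_algebra H f ->
      (op_norm [set xi | left_invariant H xi] (hecke_l2norm H)
               (hecke_convolution H f)
         <= C%:E * hecke_sobolev_norm H s L f)%E].

(* Main.v *)
Require Import Defs.
From mathcomp Require Import all_boot all_order all_algebra.
From mathcomp Require Import finmap.
From mathcomp Require Import all_classical all_reals all_analysis.

(** Write n for the order of H.  Summing over G is summing over cosets of H
    with multiplicity n ([esum_class], [fsum_class]).  So on left H-invariant
    functions the l^2 norm of G is sqrt n times that of the cosets
    ([l2norm_hecke], and [sobolev_norm_hecke] for the weighted norms), and the
    action of a bi-invariant f on the cosets is f * (xi / n)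
    ([hecke_convolutionE]).

    From G to the pair, this identification bounds the Hecke operator of f by
    the convolution operator of f.  Only the length function must change, as L
    need not vanish on H: replace L(g) by the maximum of L over HgH when g is
    not in H, and by 0 when g is in H ([hecke_length]).  The result is again a
    length function, and 1 + L is at most a constant multiple of 1 plus the
    new length ([hecke_length_ge]), so that the Sobolev norms only change by
    a constant ([sobolev_norm_le]).

    From the pair to G, a length function vanishing on H is bi-invariant and
    can be kept ([hecke_length_inv]).  An arbitrary f and xi are replaced by
    the invariant functions
      F(g) = (sum over h, k in H of |f(hgk)|^2)^(1/2),
      Xi(g) = (sum over h in H of |xi(hg)|^2)^(1/2).
    They dominate |f| and |xi|, hence |f * xi| <= F * Xi pointwise
    ([convolution_dominated]).  Since translations preserve the sums over G,
    the norm of F is n times that of f, and the norm of Xi is sqrt n times that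
    of xi ([esum_root_square_sum]).  The inequality for the pair, applied to F
    and Xi, gives the one for G with constant C n^2. *)

Set Implicit Arguments.
Unset Strict Implicit.
Unset Printing Implicit Defensive.

Import Order.TTheory GRing.Theory Num.Theory.
Import Normc.

Local Open Scope classical_set_scope.
Local Open Scope ring_scope.

(** * Sums over classes of a free action *)

Lemma esumZl (R : realType) (T : choiceType) (I : set T) (c : R) (a : T -> \bar R) :
    0 < c -> (forall i, 0 <= a i)%E ->
  (\esum_(i in I) (c%:E * a i) = c%:E * \esum_(i in I) a i)%E.
Proof.
move=> c0 a0; rewrite /esum -ereal_sup_pZl //; congr ereal_sup.
have cZ A : finite_set A ->
    (\sum_(x \in A) c%:E * a x = c%:E * \sum_(x \in A) a x)%E.
  by move=> Afin; rewrite ge0_mule_fsumr.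
apply/seteqP; split=> [_ [A /= IA <-]|_ [_ [A /= IA <-] <-]] /=.
  by exists (\sum_(x \in A) a x)%E; [exists A|rewrite cZ //; case: IA].
by exists A => //; rewrite cZ //; case: IA.
Qed.

(** Right and left cosets are treated at once: [m] is left multiplication by
    H for the former and right multiplication for the latter.  Injectivity of
    [m] in the acting element makes all classes of the same size as [I]. *)
Section SumsOverClasses.
Context {R : realType}.

Context {T U : choiceType} {I : set U} {m : U -> T -> T} (t0 : T).

Local Notation class := (fun x : T => [set m i x | i in I]).

Hypothesis class_refl : forall x, class x x.
Hypothesis class_eq : forall i x, I i -> class (m i x) = class x.
Hypothesis m_inj : forall x, injective (m^~ x).

Lemma class_repr S : range class S -> class (xget t0 S) = S.
Proof.
case=> x _ <-; have [i Ii <-] := xgetI t0 (class_refl x).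
exact: class_eq.
Qed.

(** The chosen representative of each class turns the pairs (class, element of
    [I]) into a parametrization of [T]; both sum formulas are this change of
    variables. *)
Lemma class_bij : set_bij (range class `*` I) [set: T]
  (fun p => m p.2 (xget t0 p.1)).
Proof.
split=> //.
- move=> [S i] [S' i']; rewrite !inE /= => -[cS Ii] [cS' Ii'] e.
  have eS : S = S'.
    by rewrite -(class_repr cS) -(class_repr cS') -(class_eq _ Ii) e class_eq.
  by subst S'; rewrite (m_inj e).
- move=> x _; have cx : range class (class x) by exists x.
  have := class_refl x; rewrite -(class_repr cx) => -[i Ii ix].
  by exists (class x, i).
Qed.

Hypothesis I_finite : finite_set I.

Lemma esum_class (a : T -> \bar R) :
    (forall x, 0 <= a x)%E -> (forall i x, I i -> a (m i x) = a x) ->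
  (\esum_(x in [set: T]) a x =
   (#|` fset_set I|%:R)%:E * \esum_(S in range class) a (xget t0 S))%E.
Proof.
move=> a0 am; rewrite (reindex_esum _ _ _ _ class_bij).
rewrite -[LHS](esum_esum (J := fun=> I) (a := fun S i => a (m i (xget t0 S)))) //.
have I_gt0 : 0 < #|` fset_set I|%:R :> R.
  have [i Ii _] := class_refl t0.
  by rewrite ltr0n cardfs_gt0; apply/fset0Pn; exists i; rewrite in_fset_set ?inE.
rewrite -esumZl //; apply: eq_esum => S _.
rewrite (eq_esum (b := cst (a (xget t0 S)))); last by move=> i Ii; rewrite am.
rewrite esum_fset //= fsbig_finite //= big_const_seq count_predT.
by rewrite iter_addr_0 mule_natl.
Qed.

Lemma fsum_class (V : nmodType) (a : T -> V) :
    finite_set [set x | a x <> 0] -> (forall i x, I i -> a (m i x) = a x) ->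
  \sum_(x \in [set: T]) a x =
   (\sum_(S \in range class) a (xget t0 S)) *+ #|` fset_set I|.
Proof.
move=> afin am; rewrite (reindex_fsbig _ _ _ _ class_bij).
(* The classes may be infinitely many, so the sum is first cut down to the
   finite set of those that meet the support. *)
pose P := range class `&` [set S | a (xget t0 S) <> 0].
have Pfin : finite_set P.
  apply: (@sub_finite_set _ _ (class @` [set x | a x <> 0])).
    by move=> S [cS aS]; exists (xget t0 S); rewrite ?class_repr.
  exact: finite_image.
have -> : \sum_(S \in range class) a (xget t0 S) = \sum_(S \in P) a (xget t0 S).
  exact: fsbig_supp.
rewrite -(@fsbig_widen _ _ _ _ (P `*` I)) //; first last.
- move=> [S i] /= [[cS Ii] nP]; rewrite am //; apply: contrapT => aS.
  by apply: nP.
- by move=> [S i] [[]].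
rewrite -(pair_fsbig _ (fun S i => a (m i (xget t0 S)))) //.
rewrite !(fsbig_finite _ _ Pfin) /= -sumrMnl; apply: eq_bigr => S _.
rewrite (eq_fsbigr (fun=> a (xget t0 S))); last by move=> i /set_mem Ii; exact: am.
by rewrite fsbig_finite //= big_const_seq count_predT iter_addr_0.
Qed.

End SumsOverClasses.

(** * Norms and operator norms *)

Section Norms.
Context {R : realType} {G : groupType}.
Implicit Types (L : G -> R) (f xi : G -> R[i]).

Lemma normc_ge0 (z : R[i]) : 0 <= normc z.
Proof. by case: z => a b; exact: sqrtr_ge0. Qed.

Lemma normc_real (x : R) : normc (x%:C)%C = `|x|.
Proof. by rewrite /normc /= expr0n addr0 sqrtr_sqr. Qed.

Lemma l2norm_le xi eta : (forall g, normc (xi g) <= normc (eta g)) ->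
  (l2norm xi <= l2norm eta)%E.
Proof.
move=> le_xi; rewrite lee_sqrt; last first.
  by apply: esum_ge0 => g _; rewrite lee_fin sqr_ge0.
by apply: le_esum => g _; rewrite lee_fin lerXn2r // nnegrE normc_ge0.
Qed.

Lemma l2normZ (c : R) xi : 0 < c ->
  l2norm (fun g => (c%:C)%C * xi g) = (c%:E * l2norm xi)%E.
Proof.
move=> c0; rewrite /l2norm.
rewrite (eq_esum (b := fun g => ((c ^+ 2)%:E * (normc (xi g) ^+ 2)%:E)%E)).
  rewrite esumZl ?exprn_gt0 //; last by move=> g; rewrite lee_fin sqr_ge0.
  by rewrite sqrteM ?lee_fin ?sqr_ge0 //= sqrtr_sqr gtr0_norm.
by move=> g _; rewrite normcM normc_real gtr0_norm // exprMn EFinM.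
Qed.

Lemma sobolev_norm_le (s K : R) L L' f : 0 < s -> 0 < K ->
    (forall g, 0 <= L g) -> (forall g, 0 <= L' g) ->
    (forall g, 1 + L g <= K * (1 + L' g)) ->
  (sobolev_norm s L f <= (Num.sqrt (K `^ (2 * s)))%:E * sobolev_norm s L' f)%E.
Proof.
move=> s0 K0 L0 L'0 LL'.
have Ks0 : 0 < K `^ (2 * s) by rewrite powR_gt0.
have w0 g : (0 <= (normc (f g) ^+ 2 * (1 + L' g) `^ (2 * s))%:E)%E.
  by rewrite lee_fin mulr_ge0 ?sqr_ge0 ?powR_ge0.
have -> : (Num.sqrt (K `^ (2 * s)))%:E = sqrte (K `^ (2 * s))%:E by [].
rewrite -sqrteM ?lee_fin ?powR_ge0 // lee_sqrt; last first.
  by apply: mule_ge0; [rewrite lee_fin powR_ge0|exact: esum_ge0].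
rewrite -esumZl //; apply: le_esum => g _.
rewrite -EFinM lee_fin mulrCA ler_wpM2l ?sqr_ge0 //.
have L'1 : 0 <= 1 + L' g by rewrite addr_ge0.
rewrite -powRM ?(ltW K0) // ge0_ler_powR ?nnegrE ?mulr_ge0 ?addr_ge0 ?(ltW K0) //.
exact: ltW.
Qed.

Lemma convolutionZ (c : R) f xi :
  convolution f (fun g => (c%:C)%C * xi g) =
  fun g => (c%:C)%C * convolution f xi g.
Proof.
apply/funext => g; rewrite /convolution mulr_fsumr.
by apply: eq_fsbigr => x _; rewrite mulrCA.
Qed.

Lemma ge_op_norm (D : set (G -> R[i])) (N : (G -> R[i]) -> \bar R) T xi :
  D xi -> (N xi <= 1)%E -> (N (T xi) <= op_norm D N T)%E.
Proof. by move=> Dxi Nxi; apply: ereal_sup_ubound; exists xi. Qed.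

Lemma op_norm_le (D : set (G -> R[i])) (N : (G -> R[i]) -> \bar R) T B :
  (forall xi, D xi -> (N xi <= 1)%E -> (N (T xi) <= B)%E) ->
  (op_norm D N T <= B)%E.
Proof. by move=> leB; apply: ge_ereal_sup => _ [xi [Dxi Nxi] <-]; exact: leB. Qed.

End Norms.

(** * Invariant majorants *)

Section RootSquareSum.
Context {R : realType} {G : groupType}.
Implicit Types (f F xi : G -> R[i]) (s : seq (G * G)).

(** The l^2 norm, rather than the sum or the maximum, of the translates is
    taken so that norms of the majorant are computed exactly, see
    [esum_root_square_sum]. *)
Definition root_square_sum s f : G -> R[i] := fun g =>
  ((Num.sqrt (\sum_(p <- s) normc (f (p.1 * g * p.2)%g) ^+ 2))%:C)%C.

Lemma normc_root_square_sum s f g :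
  normc (root_square_sum s f g) ^+ 2 = \sum_(p <- s) normc (f (p.1 * g * p.2)%g) ^+ 2.
Proof.
rewrite normc_real ger0_norm ?sqrtr_ge0 // sqr_sqrtr //.
by apply: sumr_ge0 => p _; exact: sqr_ge0.
Qed.

Lemma le_root_square_sum s f g : (1%g, 1%g) \in s -> `|f g| <= root_square_sum s f g.
Proof.
move=> s1; have -> : `|f g| = ((normc (f g))%:C)%C by [].
rewrite lecR -{1}[normc (f g)]ger0_norm ?normc_ge0 // -sqrtr_sqr ler_wsqrtr //.
rewrite (big_rem (1%g, 1%g)) //= mul1g mulg1 lerDl.
by apply: sumr_ge0 => p _; exact: sqr_ge0.
Qed.

Lemma root_square_sum_neq0 s f g : root_square_sum s f g != 0 ->
  exists2 p, p \in s & f (p.1 * g * p.2)%g != 0.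
Proof.
move=> Fg; apply: contrapT => nex; move/eqP: Fg; apply.
rewrite /root_square_sum big_seq big1 ?sqrtr0 // => p ps.
have [->|nz] := eqVneq (f (p.1 * g * p.2)%g) 0; first by rewrite normc0 expr0n.
by exfalso; apply: nex; exists p.
Qed.

Lemma translation_bij (a b : G) :
  set_bij [set: G] [set: G] (fun g => (a * g * b)%g).
Proof.
split=> // [x y _ _ /mulIg /mulgI //|y _].
by exists (a^-1 * y * b^-1)%g => //; rewrite !mulgA mulgV mul1g mulgVK.
Qed.

(** The square of the majorant is a sum of translates of |f|^2, each of which
    has the same weighted sum over [G] as |f|^2. *)
Lemma esum_root_square_sum s f (w : G -> R) :
    (forall g, 0 <= w g) ->
    (forall p g, p \in s -> w (p.1 * g * p.2)%g = w g) ->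
  (\esum_(g in [set: G]) (normc (root_square_sum s f g) ^+ 2 * w g)%:E =
   (size s)%:R%:E * \esum_(g in [set: G]) (normc (f g) ^+ 2 * w g)%:E)%E.
Proof.
move=> w0 ws.
have fw0 x g : (0 <= (normc (f x) ^+ 2 * w g)%:E)%E.
  by rewrite lee_fin mulr_ge0 ?sqr_ge0.
under eq_esum do rewrite normc_root_square_sum mulr_suml -sumEFin.
rewrite esum_sum // big_seq.
rewrite (eq_bigr (fun=> \esum_(g in [set: G]) (normc (f g) ^+ 2 * w g)%:E)%E).
  by rewrite -big_seq big_const_seq count_predT iter_addr_0 mule_natl.
move=> p ps; rewrite [RHS](reindex_esum _ _ _ _ (translation_bij p.1 p.2)).
by apply: eq_esum => g _; rewrite ws.
Qed.

(** In [R[i]] the inequality [`|f x| <= F x] also says that [F x] is real and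
    nonnegative.  It is the majorant [F] that must be finitely supported: a sum
    with infinitely many nonzero terms has value 0 by convention, so that it
    would bound nothing. *)
Lemma convolution_dominated f F xi Xi g : finitely_supported F ->
    (forall x, `|f x| <= F x) -> (forall x, `|xi x| <= Xi x) ->
  normc (convolution f xi g) <= normc (convolution F Xi g).
Proof.
move=> Ffin fF xiXi.
have F0 x : x \notin fset_set [set g | F g != 0] -> F x = 0.
  by rewrite in_fset_set // notin_setE /= => /negP/negPn/eqP.
have f0 x : x \notin fset_set [set g | F g != 0] -> f x = 0.
  by move/F0 => Fx; apply/eqP; rewrite -normr_le0 -Fx.
have le_conv : `|convolution f xi g| <= convolution F Xi g.
  rewrite /convolution !(@fsbigTE _ _ _ _ (fset_set [set g | F g != 0])).
  - apply: (le_trans (ler_norm_sum _ _ _)); apply: ler_sum => x _.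
    by rewrite normrM ler_pM.
  - by move=> x /F0 ->; rewrite mul0r.
  - by move=> x /f0 ->; rewrite mul0r.
rewrite -lecR; apply: (le_trans le_conv).
by rewrite -[leRHS]/`|convolution F Xi g| real_ler_norm // ger0_real // (le_trans _ le_conv).
Qed.

End RootSquareSum.

(** * Comparison of the norms of the group and of the cosets *)

Section FiniteSubgroup.
Context {R : realType} {G : groupType} {H : set G}.
Implicit Types (L : G -> R) (f F xi : G -> R[i]).
Hypotheses (H_subgroup : group_closed [in H]) (H_finite : finite_set H).

Local Notation n := #|` fset_set H|.

Lemma subgroup1 : H 1%g.
Proof. by case: H_subgroup; rewrite inE. Qed.

Lemma subgroupM h k : H h -> H k -> H (h * k)%g.
Proof.
move=> Hh Hk; suff: (h * k)%g \in [in H] by rewrite inE.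
by apply: (group_closedM H_subgroup); apply/mem_set.
Qed.

Lemma subgroupV h : H h -> H h^-1%g.
Proof.
move=> Hh; suff: h^-1%g \in [in H] by rewrite inE.
by apply: (group_closedV H_subgroup); apply/mem_set.
Qed.

Lemma subgroup_card_gt0 : (0 < n)%N.
Proof.
rewrite cardfs_gt0; apply/fset0Pn; exists 1%g.
by rewrite in_fset_set //; apply/mem_set/subgroup1.
Qed.

Lemma subgroup_card_ge1 : 1 <= n%:R :> R.
Proof. by rewrite ler1n subgroup_card_gt0. Qed.

Lemma right_coset_refl g : right_coset H g g.
Proof. by exists 1%g; [exact: subgroup1|rewrite mul1g]. Qed.

Lemma right_coset_eq h g : H h -> right_coset H (h * g)%g = right_coset H g.
Proof.
move=> Hh; apply/seteqP; split=> _ [k Hk <-].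
  by exists (k * h)%g; [exact: subgroupM|rewrite mulgA].
exists (k * h^-1)%g; first exact/subgroupM/subgroupV.
by rewrite mulgA mulgVK.
Qed.

Lemma left_coset_refl g : left_coset H g g.
Proof. by exists 1%g; [exact: subgroup1|rewrite mulg1]. Qed.

Lemma left_coset_eq h g : H h -> left_coset H (g * h)%g = left_coset H g.
Proof.
move=> Hh; apply/seteqP; split=> _ [k Hk <-].
  by exists (h * k)%g; [exact: subgroupM|rewrite mulgA].
exists (h^-1 * k)%g; first exact/subgroupM/Hk/subgroupV.
by rewrite mulgA mulgK.
Qed.

Lemma double_coset_eq h k g : H h -> H k ->
  double_coset H (h * g * k)%g = double_coset H g.
Proof.
have sub h' k' g' : H h' -> H k' ->
    double_coset H (h' * g' * k')%g `<=` double_coset H g'.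
  move=> Hh Hk _ [a Ha [b Hb <-]]; exists (a * h')%g; first exact: subgroupM.
  by exists (k' * b)%g; [exact: subgroupM|rewrite !mulgA].
move=> Hh Hk; apply/seteqP; split; first exact: sub.
have {1}-> : g = (h^-1 * (h * g * k) * k^-1)%g by rewrite !mulgA mulVg mul1g mulgK.
by apply: sub; exact: subgroupV.
Qed.

Lemma hecke_pair_finite : hecke_pair H.
Proof.
split=> // g; exists (right_coset H g); split; first exact: finite_image.
apply/seteqP; split=> [_ [h Hh [k Hk <-]]|_ [_ [h Hh <-] [k Hk <-]]].
  by exists (h * g)%g; [exists h|exists k].
by exists h => //; exists k.
Qed.

Lemma hecke_algebra_finitely_supported f :
  hecke_algebra H f -> finitely_supported f.
Proof.
move=> [_ ffin].
apply: (@sub_finite_set _ _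
  (\bigcup_(D in [set double_coset H g | g in [set g | f g != 0]]) D)).
  move=> g fg; exists (double_coset H g); first by exists g.
  by exists 1%g; [|exists 1%g]; rewrite ?mul1g ?mulg1 //; exact: subgroup1.
apply: bigcup_finite => // _ [g _ <-].
apply: (@sub_finite_set _ _ ((fun p => p.1 * g * p.2)%g @` (H `*` H))).
  by move=> _ [h Hh [k Hk <-]]; exists (h, k).
by apply: finite_image; exact: finite_setX.
Qed.

Lemma esum_right_cosets (a : G -> \bar R) : (forall g, 0 <= a g)%E ->
    (forall h g, H h -> a (h * g)%g = a g) ->
  (\esum_(g in [set: G]) a g =
   n%:R%:E * \esum_(S in right_cosets H) a (coset_repr S))%E.
Proof.
apply: (esum_class 1%g right_coset_refl) => //.
- by move=> h g; exact: right_coset_eq.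
- by move=> g x y /mulIg.
Qed.

Lemma l2norm_hecke xi : left_invariant H xi ->
  l2norm xi = ((Num.sqrt n%:R)%:E * hecke_l2norm H xi)%E.
Proof.
move=> inv_xi; rewrite /l2norm esum_right_cosets ?sqrteM //.
- by move=> g; rewrite lee_fin sqr_ge0.
- by move=> h g Hh; rewrite inv_xi.
Qed.

Lemma hecke_l2norm_le xi : left_invariant H xi ->
  (hecke_l2norm H xi <= l2norm xi)%E.
Proof.
move=> inv_xi; rewrite l2norm_hecke //; apply: lee_pemull; first exact: sqrte_ge0.
by rewrite (lee_fin 1) -[leLHS]sqrtr1 ler_wsqrtr // subgroup_card_ge1.
Qed.

(** L(hgk) <= L(h) + L(g) + L(k) = L(g), and g is in turn a translate of hgk. *)
Lemma hecke_length_inv L h k g : hecke_length_function H L -> H h -> H k ->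
  L (h * g * k)%g = L g.
Proof.
move=> [[L0 LM LV L1] LH].
have le h' k' g' : H h' -> H k' -> L (h' * g' * k')%g <= L g'.
  move=> Hh Hk; apply: (le_trans (LM _ _)); rewrite (LH _ Hk) addr0.
  by apply: (le_trans (LM _ _)); rewrite (LH _ Hh) add0r.
move=> Hh Hk; apply/eqP; rewrite eq_le le //=.
have {1}-> : g = (h^-1 * (h * g * k) * k^-1)%g by rewrite !mulgA mulVg mul1g mulgK.
by apply: le; exact: subgroupV.
Qed.

Lemma sobolev_norm_hecke (s : R) L f :
    hecke_length_function H L -> bi_invariant H f ->
  sobolev_norm s L f = ((Num.sqrt n%:R)%:E * hecke_sobolev_norm H s L f)%E.
Proof.
move=> hL inv_f; rewrite /sobolev_norm esum_right_cosets ?sqrteM //.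
- by move=> g; rewrite lee_fin mulr_ge0 ?sqr_ge0 ?powR_ge0.
- move=> h g Hh; have := inv_f h g 1%g Hh subgroup1.
  have := hecke_length_inv g hL Hh subgroup1.
  by rewrite mulg1 => -> ->.
Qed.

(** The summand of the convolution is constant on left cosets because [f] is
    invariant on the right and [xi] on the left; each coset is thus counted n
    times. *)
Lemma hecke_convolutionE f xi : hecke_algebra H f -> left_invariant H xi ->
  hecke_convolution H f xi = convolution f (fun g => ((n%:R^-1)%:C)%C * xi g).
Proof.
move=> Hf inv_xi; have [inv_f _] := Hf.
have cn : ((n%:R^-1 : R)%:C)%C *+ n = 1.
  rewrite -rmorphMn -[_ *+ n](mulr_natr n%:R^-1) mulVf ?rmorph1 //.
  by rewrite pnatr_eq0 -lt0n subgroup_card_gt0.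
rewrite convolutionZ; apply/funext => g.
rewrite /convolution (fsum_class 1%g left_coset_refl (m := fun h x => (x * h)%g)) //.
- by rewrite mulrnAr -mulrnAl cn mul1r.
- by move=> h x; exact: left_coset_eq.
- by move=> x a b /mulgI.
- apply: sub_finite_set (hecke_algebra_finitely_supported Hf) => x /eqP.
  by apply: contraNneq => ->; rewrite mul0r.
- move=> h x Hh; have := inv_f 1%g x h subgroup1 Hh; rewrite mul1g => ->.
  by rewrite invgM -mulgA inv_xi //; exact: subgroupV.
Qed.

Lemma convolution_left_invariant f xi :
  bi_invariant H f -> left_invariant H (convolution f xi).
Proof.
move=> inv_f h g Hh; rewrite /convolution.
rewrite (reindex_fsbig _ _ _ _ (translation_bij h 1%g)).
apply: eq_fsbigr => x _; rewrite inv_f //; last exact: subgroup1.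
by rewrite mulg1 invgM -mulgA mulKg.
Qed.

(** * From the group to the Hecke pair *)

Definition subgroup_pairs : seq (G * G) :=
  [seq (h, k) | h <- fset_set H, k <- fset_set H].

Lemma subgroup_pairsP p : reflect (H p.1 /\ H p.2) (p \in subgroup_pairs).
Proof.
apply: (iffP allpairsP) => [[q [q1 q2 ->]]|[H1 H2]].
  by move: q1 q2; rewrite !in_fset_set ?inE.
by exists p; rewrite !in_fset_set ?inE //; split=> //; case: (p).
Qed.

Definition max_length L g : R :=
  \big[Num.max/0]_(p <- subgroup_pairs) L (p.1 * g * p.2)%g.

Lemma le_max_length L g h k : H h -> H k -> L (h * g * k)%g <= max_length L g.
Proof.
move=> Hh Hk; apply: (@bigmax_sup_seq _ _ _ _ _ (h, k)) => //.
exact/subgroup_pairsP.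
Qed.

Lemma max_length_le L g c : 0 <= c ->
  (forall h k, H h -> H k -> L (h * g * k)%g <= c) -> max_length L g <= c.
Proof.
move=> c0 Lc; rewrite /max_length big_seq; apply: bigmax_le => // p.
by move=> /subgroup_pairsP[H1 H2]; exact: Lc.
Qed.

(** The maximum over HgH alone is subadditive and symmetric, but it need not be
    0 on H.  Resetting it there keeps subadditivity, because multiplying by an
    element of H does not change the maximum. *)
Definition hecke_length L g : R := if g \in H then 0 else max_length L g.

Lemma hecke_length_is_length L : length_function L ->
  hecke_length_function H (hecke_length L).
Proof.
move=> [L0 LM LV L1].
have H1 := subgroup1.
have max0 g : 0 <= max_length L g.
  exact: le_trans (L0 _) (le_max_length L g H1 H1).
have hl0 g : 0 <= hecke_length L g by rewrite /hecke_length; case: ifP.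
have maxM g x : H g -> max_length L (g * x)%g <= max_length L x.
  move=> Hg; apply: max_length_le => // h k Hh Hk; rewrite mulgA.
  by apply: le_max_length => //; exact: subgroupM.
have maxMr x g : H g -> max_length L (x * g)%g <= max_length L x.
  move=> Hg; apply: max_length_le => // h k Hh Hk; rewrite -!mulgA mulgA.
  by apply: le_max_length => //; exact: subgroupM.
have maxV g : max_length L g^-1%g <= max_length L g.
  apply: max_length_le => // h k Hh Hk.
  rewrite LV !invgM invgK mulgA; apply: le_max_length; exact: subgroupV.
have inHV g : (g^-1%g \in H) = (g \in H).
  apply/idP/idP => /set_mem Hg; apply/mem_set; last exact: subgroupV.
  by rewrite -[g]invgK; exact: subgroupV.
split; last by move=> h Hh; rewrite /hecke_length mem_set.
split=> // [g x|g|]; rewrite /hecke_length.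
- have [|gxH] := ifPn ((g * x)%g \in H); first by rewrite addr_ge0 // hl0.
  case: ifPn => [/set_mem Hg|gH].
    rewrite add0r; case: ifPn => [/set_mem Hx|_]; last exact: maxM.
    by case/negP: gxH; apply/mem_set/subgroupM.
  case: ifPn => [/set_mem Hx|xH]; first by rewrite addr0; exact: maxMr.
  apply: max_length_le; first by rewrite addr_ge0.
  move=> h k Hh Hk.
  (* h g x k = (h g)(x k), whose factors lie in HgH and HxH. *)
  have -> : (h * (g * x) * k = (h * g * 1) * (1 * x * k))%g.
    by rewrite mulg1 mul1g !mulgA.
  by apply: le_trans (LM _ _) _; apply: lerD; exact: le_max_length.
- rewrite inHV; case: ifP => // _; apply/eqP; rewrite eq_le maxV.
  by rewrite -{1}[g]invgK maxV.
- by rewrite mem_set.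
Qed.

(** Off H the length only grows; on H it drops to 0, and the maximum of [L] over
    H, which is [max_length L 1], bounds the loss. *)
Lemma hecke_length_ge L : length_function L ->
  forall g, 1 + L g <= (1 + max_length L 1%g) * (1 + hecke_length L g).
Proof.
move=> Llen g; have [[hl0 _ _ _] _] := hecke_length_is_length Llen.
have [L0 _ _ _] := Llen; have H1 := subgroup1.
have max0 : 0 <= max_length L 1%g.
  exact: le_trans (L0 _) (le_max_length L 1%g H1 H1).
rewrite mulrDl mul1r -addrA lerD2l /hecke_length.
case: ifPn => [/set_mem Hg|_].
  by rewrite add0r addr0 mulr1; have := le_max_length L 1%g Hg H1; rewrite !mulg1.
apply: (@le_trans _ _ (max_length L g)).
  by have := le_max_length L g H1 H1; rewrite mul1g mulg1.
rewrite lerDl mulr_ge0 // addr_ge0 //.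
by apply: le_trans (L0 _) (le_max_length L g H1 H1).
Qed.

(** Let xi have norm at most 1 on the cosets.  Then eta = xi / n has norm at
    most 1 / sqrt n <= 1 in l^2(G), and f * eta is the image of xi under the
    Hecke operator of f, whose norm on the cosets is at most its norm in
    l^2(G). *)
Lemma property_RD_hecke : property_RD R G -> hecke_property_RD R H.
Proof.
move=> [L [Llen [C [s [C0 s0 RD]]]]].
have hL := hecke_length_is_length Llen; have [[hl0 _ _ _] _] := hL.
have [L0 _ _ _] := Llen.
pose K := 1 + max_length L 1%g.
have K0 : 0 < K.
  rewrite ltr_pwDl //; apply: le_trans (L0 _) (le_max_length L 1%g _ _); exact: subgroup1.
have n1 := subgroup_card_ge1.
have n0 : 0 < n%:R :> R by apply: lt_le_trans n1.
exists (hecke_length L); split=> //.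
exists (C * (Num.sqrt (K `^ (2 * s)) * Num.sqrt n%:R)), s; split=> //.
  by rewrite !mulr_gt0 // sqrtr_gt0 // powR_gt0.
move=> f Hf; have [inv_f _] := Hf; apply: op_norm_le => xi inv_xi xi1.
rewrite hecke_convolutionE //.
set eta := (X in convolution f X).
have eta1 : (l2norm eta <= 1)%E.
  rewrite l2normZ ?invr_gt0 // l2norm_hecke // muleA -EFinM.
  rewrite -[leRHS]mule1; apply: lee_pmul => //; first exact: sqrte_ge0.
  rewrite (lee_fin _ 1) mulrC ler_pdivrMr // mul1r.
  rewrite -[leRHS]ger0_norm ?(ltW n0) // -sqrtr_sqr ler_wsqrtr //.
  by rewrite expr2 ler_peMl // ltW.
apply: (le_trans (hecke_l2norm_le (convolution_left_invariant eta inv_f))).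
have etaT : [set: G -> R[i]] eta by [].
apply: (le_trans (ge_op_norm (convolution f) etaT eta1)).
apply: (le_trans (RD f (hecke_algebra_finitely_supported Hf))).
rewrite !EFinM -muleA lee_wpmul2l ?lee_fin ?(ltW C0) //.
rewrite -muleA -sobolev_norm_hecke //.
exact: (sobolev_norm_le _ s0 K0 L0 hl0 (hecke_length_ge Llen)).
Qed.

(** * From the Hecke pair to the group *)

Lemma sum_subgroup_mulr (u : G -> R) k : H k ->
  \sum_(h <- fset_set H) u (h * k)%g = \sum_(h <- fset_set H) u h.
Proof.
move=> Hk; rewrite -!fsbig_finite //; apply/esym/reindex_fsbig; split=> /=.
- by move=> h Hh; exact: subgroupM.
- by move=> x y _ _ /mulIg.
- move=> h Hh; exists (h * k^-1)%g; first exact/subgroupM/subgroupV.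
  by rewrite mulgVK.
Qed.

Lemma sum_subgroup_mull (u : G -> R) k : H k ->
  \sum_(h <- fset_set H) u (k * h)%g = \sum_(h <- fset_set H) u h.
Proof.
move=> Hk; rewrite -!fsbig_finite //; apply/esym/reindex_fsbig; split=> /=.
- by move=> h Hh; exact: subgroupM.
- by move=> x y _ _ /mulgI.
- move=> h Hh; exists (k^-1 * h)%g; first exact/subgroupM/Hh/subgroupV.
  by rewrite mulVKg.
Qed.

Definition left_pairs : seq (G * G) := [seq (h, 1%g) | h <- fset_set H].

Lemma root_square_sum_left_invariant xi : left_invariant H (root_square_sum left_pairs xi).
Proof.
move=> h g Hh; rewrite /root_square_sum !big_map /=; congr (Num.sqrt _)%:C%C.
under eq_bigr do rewrite mulgA.
exact: (sum_subgroup_mulr (fun x => normc (xi (x * g * 1)%g) ^+ 2)).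
Qed.

Lemma root_square_sum_bi_invariant f : bi_invariant H (root_square_sum subgroup_pairs f).
Proof.
move=> h g k Hh Hk; rewrite /root_square_sum !big_allpairs /=; congr (Num.sqrt _)%:C%C.
rewrite -[RHS](sum_subgroup_mulr _ Hh); apply: eq_bigr => a _.
rewrite -[RHS](sum_subgroup_mull _ Hk); apply: eq_bigr => b _.
by rewrite !mulgA.
Qed.

Lemma root_square_sum_hecke_algebra f : finitely_supported f ->
  hecke_algebra H (root_square_sum subgroup_pairs f).
Proof.
move=> ffin; split; first exact: root_square_sum_bi_invariant.
apply: (@sub_finite_set _ _ (double_coset H @` [set g | f g != 0])).
  move=> _ [g /root_square_sum_neq0[p /subgroup_pairsP[H1 H2] fg] <-].
  by exists (p.1 * g * p.2)%g => //; exact: double_coset_eq.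
exact: finite_image.
Qed.

Lemma l2norm_root_square_sum xi :
  l2norm (root_square_sum left_pairs xi) = ((Num.sqrt n%:R)%:E * l2norm xi)%E.
Proof.
rewrite /l2norm; under eq_esum do rewrite -[_ ^+ 2]mulr1.
rewrite esum_root_square_sum // sqrteM ?lee_fin //= size_map.
by under [in RHS]eq_esum do rewrite -[_ ^+ 2]mulr1.
Qed.

Lemma sobolev_norm_root_square_sum (s : R) L f : hecke_length_function H L ->
  sobolev_norm s L (root_square_sum subgroup_pairs f) = (n%:R%:E * sobolev_norm s L f)%E.
Proof.
move=> hL; rewrite /sobolev_norm esum_root_square_sum.
- by rewrite sqrteM ?lee_fin //= size_allpairs natrM -expr2 sqrtr_sqr ger0_norm.
- by move=> g; exact: powR_ge0.
- by move=> p g /subgroup_pairsP[H1 H2]; rewrite (hecke_length_inv _ hL).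
Qed.

(** With F and Xi the majorants of f and xi, F * Xi is n times the Hecke
    convolution of F and Xi, where Xi has norm at most 1 on the cosets.  This
    factor n and the factor n between the norms of F and f give C n^2; the
    factor sqrt n between the l^2 norms of the group and of the cosets cancels
    with the one between the Sobolev norms. *)
Lemma hecke_property_RD_group : hecke_property_RD R H -> property_RD R G.
Proof.
move=> [L [hL [C [s [C0 s0 RD]]]]].
have n1 := subgroup_card_ge1.
have n0 : 0 < n%:R :> R by apply: lt_le_trans n1.
have sn0 : 0 < Num.sqrt n%:R :> R by rewrite sqrtr_gt0.
exists L; split; first by case: hL.
exists (C * n%:R ^+ 2), s; split=> //; first by rewrite mulr_gt0 ?exprn_gt0.
move=> f ffin; apply: op_norm_le => xi _ xi1.
pose F := root_square_sum subgroup_pairs f; pose Xi := root_square_sum left_pairs xi.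
have HF : hecke_algebra H F by exact: root_square_sum_hecke_algebra.
have inv_Xi : left_invariant H Xi by exact: root_square_sum_left_invariant.
have hXi1 : (hecke_l2norm H Xi <= 1)%E.
  rewrite -(@lee_pmul2l _ (Num.sqrt n%:R)%:E) ?lte_fin //.
  by rewrite -l2norm_hecke // l2norm_root_square_sum lee_pmul2l ?lte_fin.
have convE : convolution F Xi = fun g => ((n%:R)%:C)%C * hecke_convolution H F Xi g.
  rewrite hecke_convolutionE // convolutionZ; apply/funext => g.
  by rewrite mulrA -rmorphM mulfV ?gt_eqF // rmorph1 mul1r.
have inv_conv : left_invariant H (hecke_convolution H F Xi).
  by rewrite hecke_convolutionE //; apply: convolution_left_invariant; case: HF.
have sF : ((Num.sqrt n%:R)%:E * hecke_sobolev_norm H s L F =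
           n%:R%:E * sobolev_norm s L f)%E.
  by rewrite -sobolev_norm_hecke ?sobolev_norm_root_square_sum //; case: HF.
have -> : ((C * n%:R ^+ 2)%:E * sobolev_norm s L f =
    n%:R%:E * ((Num.sqrt n%:R)%:E * (C%:E * hecke_sobolev_norm H s L F)))%E.
  rewrite (muleCA (Num.sqrt n%:R)%:E) sF !muleA -!EFinM expr2.
  by congr (_%:E * _)%E; rewrite mulrA mulrC mulrA.
apply: (@le_trans _ _ (l2norm (convolution F Xi))).
  apply: l2norm_le => g; apply: convolution_dominated.
  - exact: hecke_algebra_finitely_supported.
  - by move=> x; apply: le_root_square_sum; apply/subgroup_pairsP; split; exact: subgroup1.
  - move=> x; apply: le_root_square_sum; apply/mapP; exists 1%g => //.
    by rewrite in_fset_set //; apply/mem_set/subgroup1.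
rewrite convE l2normZ // l2norm_hecke //.
rewrite !lee_pmul2l ?lte_fin //.
exact: (le_trans (ge_op_norm (hecke_convolution H F) inv_Xi hXi1) (RD F HF)).
Qed.

End FiniteSubgroup.

Theorem theorem2p11 (R : realType) (G : groupType) (H : set G)
    (H_subgroup : group_closed [in H]) (H_finite : finite_set H) :
  hecke_pair H /\ (property_RD R G <-> hecke_property_RD R H).
Proof.
split; first exact: hecke_pair_finite.
by split; [exact: property_RD_hecke|exact: hecke_property_RD_group].
Qed.
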